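(* Let $I$ be an infinite set and, for each $i\in I$, let $\pi_i:G_i\to U_{\mathcal L(H_i)}$ be a unitary representation of a group $G_i$ on a non-zero Hilbert space $H_i$. (a) There exist canonical unitary representations $\bigotimes^{\phi_1}_{i\in I}\pi_i$ and $\prod\otimes_{i\in I}\pi_i$ of the group $\prod_{i\in I}G_i$ on $\bar\bigotimes^{\phi_1}_{i\in I}H_i$ and on $\prod\otimes_{i\in I}H_i$ respectively, i.e. representations with $\big(\bigotimes^{\phi_1}_{i\in I}\pi_i\big)(g)(\otimes_{i\in I}\xi_i)=\otimes_{i\in I}\pi_i(g_i)\xi_i$ and $\big(\prod\otimes_{i\in I}\pi_i\big)(g)\big(\prod\otimes_{i\in I}\xi_i\big)=\prod\otimes_{i\in I}\pi_i(g_i)\xi_i$ for all $g\in\prod_{i\in I}G_i$ and all families $\xi=[\xi_i]_{i\in I}$ of unit vectors $\xi_i\in H_i$. (b) If the induced $^*$-representation $\hat\pi_i:\mathbb C[G_i]\to\mathcal L(H_i)$ is injective for all $i\in I$, then the $^*$-representation $\widehat{\bigotimes^{\phi_1}_{i\in I}\pi_i}$ of $\mathbb C[\prod_{i\in I}G_i]$ induced by $\bigotimes^{\phi_1}_{i\in I}\pi_i$ is also injective.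
   Context: $\mathcal L(H)$ is the algebra of bounded operators on $H$, $U_{\mathcal L(H)}$ its unitary group, and $\mathbb C[G]$ the group $^*$-algebra. No topology on the groups is involved. $\bigotimes_{i\in I}H_i$ is the vector space with a multilinear (linear in each variable separately) map $\Theta_H:x\mapsto\otimes_{i\in I}x_i$ from $\prod_{i\in I}H_i$ through which every multilinear map on $\prod_{i\in I}H_i$ factors via a unique linear map. With $\mathfrak S_1(H_i)$ the unit sphere of $H_i$, let $\bigotimes^{\rm un}_{i\in I}H_i=\mathrm{span}\,\Theta_H(\prod_{i\in I}\mathfrak S_1(H_i))$. It carries an inner product $\langle\cdot,\cdot\rangle_{\phi_1}$ given, for $x,y\in\prod_{i\in I}\mathfrak S_1(H_i)$, by $\langle\otimes x_i,\otimes y_i\rangle_{\phi_1}=\prod_{i\in I}\langle x_i,y_i\rangle$ if $\langle x_i,y_i\rangle=1$ for all but finitely many $i$, and $0$ otherwise. $\bar\bigotimes^{\phi_1}_{i\in I}H_i$ is the completion. $\prod\otimes_{i\in I}H_i$ is von Neumann's infinite direct product: a family $x\in\prod_{i\in I}H_i$ is a $C_0$-sequence if $\sum_{i\in I}\big|\|x_i\|-1\big|<\infty$, and for $C_0$-sequences $x\approx y$ means $\sum_{i\in I}|\langle x_i,y_i\rangle-1|<\infty$; $\prod\otimes_{i\in I}H_i$ is the Hilbert space with a total family of vectors $\prod\otimes_{i\in I}x_i$ ($x$ a $C_0$-sequence) satisfying $\langle\prod\otimes_{i\in I}x_i,\prod\otimes_{i\in I}y_i\rangle=\prod_{i\in I}\langle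 x_i,y_i\rangle$ (the limit of the finite partial products) if $x\approx y$, and $0$ otherwise. *)

(* Defs.v *)
From HB Require Import structures.
From mathcomp Require Import all_boot all_order all_algebra finmap.
From mathcomp Require Import boolp classical_sets functions cardinality.
From mathcomp Require Import fsbigop reals ereal topology normedtype esum.
From mathcomp Require Import complex sesquilinear.
From mathcomp.analysis.showcase Require summability.

Set Implicit Arguments.
Unset Strict Implicit.
Unset Printing Implicit Defensive.

Import Order.TTheory GRing.Theory Num.Theory.
Import numFieldNormedType.Exports.

Local Open Scope classical_set_scope.
Local Open Scope ring_scope.

(* Inner products are linear in the first variable, conjugate-linear in the
   second one. The norm of a normed module over R[i] takes its values in R[i]. *)
HB.mixin Record CompleteNormedModule_isHilbert (R : realType) H
    of CompleteNormedModule R[i] H := {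
  inner : {dot H for Num.Def.conjC} ;
  inner_normE : forall x : H, `|x| ^+ 2 = inner x x
}.

#[short(type="hilbertType")]
HB.structure Definition Hilbert (R : realType) :=
  {H of CompleteNormedModule_isHilbert R H & CompleteNormedModule R[i] H}.

Section bounded_operators.
Context {R : realType} (H : hilbertType R).

Definition bounded_operator : {pred H -> H} := [pred A : H -> H |
  `[< linear A /\ exists M : R[i], forall x, `|A x| <= M * `|x| >]].

Lemma bounded_operatorP (A : H -> H) :
  reflect (linear A /\ exists M : R[i], forall x, `|A x| <= M * `|x|)
          (A \in bounded_operator).
Proof. exact: asboolP. Qed.

Fact bounded_operator_submod_closed : submod_closed bounded_operator.
Proof.
split=> [|a A B /bounded_operatorP[lA [M AM]] /bounded_operatorP[lB [N BN]]].
  apply/bounded_operatorP; split=> [a x y|].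
    by rewrite /GRing.zero/= scaler0 addr0.
  by exists 0 => x; rewrite normr0 mul0r.
apply/bounded_operatorP; split=> [b x y|].
  change (a *: A (b *: x + y) + B (b *: x + y) =
    b *: (a *: A x + B x) + (a *: A y + B y)).
  rewrite lA lB !scalerDr !scalerA (mulrC a) -!addrA; congr (_ + _).
  by rewrite addrCA.
exists (`|a| * M + N) => x; change (`|a *: A x + B x| <= (`|a| * M + N) * `|x|).
rewrite (le_trans (ler_normD _ _))// mulrDl lerD// normrZ -mulrA.
exact: ler_wpM2l.
Qed.
HB.instance Definition _ :=
  GRing.isSubmodClosed.Build _ _ bounded_operator bounded_operator_submod_closed.

Record bounded := Bounded {
  bounded_fun :> H -> H ; _ : bounded_fun \in bounded_operator }.
HB.instance Definition _ := [isSub for bounded_fun].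
HB.instance Definition _ := [Choice of bounded by <:].
HB.instance Definition _ := [SubChoice_isSubLmodule of bounded by <:].

Lemma boundedP (A B : bounded) : A =1 B -> A = B.
Proof. by move=> AB; apply/val_inj/funext. Qed.

Lemma bounded_linear (A : bounded) : linear A.
Proof. by case: A => A /= /bounded_operatorP[]. Qed.

Lemma bounded_bound (A : bounded) : exists M : R[i], forall x, `|A x| <= M * `|x|.
Proof. by case: A => A /= /bounded_operatorP[]. Qed.

HB.instance Definition _ (A : bounded) :=
  GRing.isLinear.Build _ _ _ _ A (bounded_linear A).

Fact bounded_id_subproof : idfun \in bounded_operator.
Proof.
by apply/bounded_operatorP; split=> //; exists 1 => x; rewrite mul1r.
Qed.
Definition bounded_id : bounded := Bounded bounded_id_subproof.

Fact bounded_comp_subproof (A B : bounded) : A \o B \in bounded_operator.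
Proof.
apply/bounded_operatorP; split=> [a x y /=|]; first by rewrite !linearP.
have [[M AM] [N BN]] := (bounded_bound A, bounded_bound B).
exists (`|M| * N) => x /=.
have := AM (B x); have [M0|M0] := eqVneq (B x) 0.
  rewrite M0 normr0 mulr0 linear0 normr0 => _.
  by rewrite -mulrA mulr_ge0// (le_trans _ (BN x)).
move=> AMB; rewrite -mulrA (le_trans _ (ler_wpM2l _ (BN x)))//.
have M_ge0 : 0 <= M.
  by rewrite -(pmulr_lge0 _ (_ : 0 < `|B x|)) ?normr_gt0// (le_trans _ AMB).
by rewrite (ger0_norm M_ge0).
Qed.
Definition bounded_comp (A B : bounded) : bounded :=
  Bounded (bounded_comp_subproof A B).

Fact bounded_compDl : left_distributive bounded_comp +%R.
Proof. by move=> A B C; apply: boundedP. Qed.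
Fact bounded_compDr : right_distributive bounded_comp +%R.
Proof. by move=> A B C; apply: boundedP => x; exact: (linearD A). Qed.
Fact bounded_compA : associative bounded_comp.
Proof. by move=> A B C; apply: boundedP. Qed.
Fact bounded_comp1l : left_id bounded_id bounded_comp.
Proof. by move=> A; apply: boundedP. Qed.
Fact bounded_compl1 : right_id bounded_id bounded_comp.
Proof. by move=> A; apply: boundedP. Qed.
HB.instance Definition _ := GRing.Zmodule_isPzRing.Build bounded
  bounded_compA bounded_comp1l bounded_compl1 bounded_compDl bounded_compDr.

Lemma bounded_scalerAl (a : R[i]) (A B : bounded) : a *: (A * B) = a *: A * B.
Proof. exact: boundedP. Qed.
Lemma bounded_scalerAr (a : R[i]) (A B : bounded) : a *: (A * B) = A * (a *: B).
Proof. by apply: boundedP => x; symmetry; exact: linearZ_LR. Qed.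

End bounded_operators.

Notation "''L' ( H )" := (bounded H) (at level 8, format "''L' ( H )") : type_scope.

Section unitary_representation.
Context {R : realType} {H : hilbertType R}.

Lemma boundedD (A B : 'L(H)) x : (A + B) x = A x + B x. Proof. by []. Qed.
Lemma boundedZ a (A : 'L(H)) x : (a *: A) x = a *: A x. Proof. by []. Qed.
Lemma boundedM (A B : 'L(H)) x : (A * B) x = A (B x). Proof. by []. Qed.
Lemma bounded_sum I (r : seq I) (A : I -> 'L(H)) x :
  (\sum_(i <- r) A i) x = \sum_(i <- r) A i x.
Proof. by elim/big_rec2: _ => // i y1 y2 _ <-. Qed.
Lemma bounded1 x : (1 : 'L(H)) x = x. Proof. by []. Qed.

(* A relation: the existence of adjoints is the Riesz representation theorem,
   which is not needed to define unitary operators. *)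
Definition is_adjoint (A B : 'L(H)) := forall x y, inner (A x) y = inner x (B y).

Definition unitary (U : 'L(H)) :=
  exists V, [/\ is_adjoint U V, U * V = 1 & V * U = 1].

Definition unitary_representation (G : groupType) (pi : G -> 'L(H)) :=
  (forall g, unitary (pi g)) /\ {morph pi : g h / (g * h)%g >-> g * h}.

Lemma unitary_norm (U : 'L(H)) x : unitary U -> `|U x| = `|x|.
Proof.
case=> V [UV _ VU]; apply/eqP; rewrite -(@eqrXn2 _ 2)// !inner_normE UV.
by rewrite -boundedM VU bounded1.
Qed.

End unitary_representation.


Definition group_algebra (R : realType) (G : groupType) :=
  {fsfun G -> R[i] with 0}.

Section group_algebra.
Context {R : realType} {G : groupType}.
Local Notation CG := (group_algebra R G).
Implicit Types f : CG.

HB.instance Definition _ := Choice.on CG.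

Lemma group_algebraP f1 f2 : f1 =1 f2 -> f1 = f2.
Proof. by move=> /fsfunP. Qed.

Definition ga_zero : CG := [fsfun for fun=> 0].
Definition ga_add f1 f2 : CG :=
  [fsfun g in (finsupp f1 `|` finsupp f2)%fset => f1 g + f2 g].
Definition ga_scale a f : CG := [fsfun g in finsupp f => a * f g].

Fact ga_zeroE g : ga_zero g = 0. Proof. exact: fsfun0E. Qed.
Fact ga_addE f1 f2 g : ga_add f1 f2 g = f1 g + f2 g.
Proof.
by rewrite fsfunE inE; case: (finsuppP f1); case: (finsuppP f2) => //= _; rewrite addr0.
Qed.
Fact ga_scaleE a f g : ga_scale a f g = a * f g.
Proof. by rewrite fsfunE; case: finsuppP => //=; rewrite mulr0. Qed.

Fact ga_addA : associative ga_add.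
Proof. by move=> f1 f2 f3; apply: group_algebraP => g; rewrite !ga_addE addrA. Qed.
Fact ga_addC : commutative ga_add.
Proof. by move=> f1 f2; apply: group_algebraP => g; rewrite !ga_addE addrC. Qed.
Fact ga_add0 : left_id ga_zero ga_add.
Proof. by move=> f; apply: group_algebraP => g; rewrite ga_addE ga_zeroE add0r. Qed.
Fact ga_addN : left_inverse ga_zero (ga_scale (- 1)) ga_add.
Proof.
move=> f; apply: group_algebraP => g.
by rewrite ga_addE ga_scaleE ga_zeroE mulN1r addNr.
Qed.
HB.instance Definition _ :=
  GRing.isZmodule.Build CG ga_addA ga_addC ga_add0 ga_addN.

Fact ga_scaleA a b f : ga_scale a (ga_scale b f) = ga_scale (a * b) f.
Proof. by apply: group_algebraP => g; rewrite !ga_scaleE mulrA. Qed.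
Fact ga_scale1 : left_id 1 ga_scale.
Proof. by move=> f; apply: group_algebraP => g; rewrite ga_scaleE mul1r. Qed.
Fact ga_scaleDr : right_distributive ga_scale +%R.
Proof.
move=> a f1 f2; apply: group_algebraP => g.
by rewrite !(ga_scaleE, ga_addE) mulrDr.
Qed.
Fact ga_scaleDl f : {morph ga_scale^~ f : a b / a + b}.
Proof.
move=> a b; apply: group_algebraP => g.
by rewrite !(ga_scaleE, ga_addE) mulrDl.
Qed.
HB.instance Definition _ :=
  GRing.Zmodule_isLmodule.Build _ CG ga_scaleA ga_scale1 ga_scaleDr ga_scaleDl.

Lemma group_algebraD f1 f2 g : (f1 + f2) g = f1 g + f2 g.
Proof. exact: ga_addE. Qed.
Lemma group_algebraZ a f g : (a *: f) g = a * f g.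
Proof. exact: ga_scaleE. Qed.

Definition ga_delta (g : G) : CG := [fsfun h in [fset g]%fset => 1].

Lemma ga_deltaE g h : ga_delta g h = (h == g)%:R.
Proof. by rewrite fsfunE inE; case: eqP. Qed.

(* The linear map on the group algebra that sends each g in G to phi g. *)
Definition linear_ext {V : lmodType R[i]} (phi : G -> V) (f : CG) : V :=
  \sum_(g <- finsupp f) f g *: phi g.

Section linear_ext.
Context {V : lmodType R[i]}.
Implicit Types phi : G -> V.

Lemma linear_ext_sub phi f (A : {fset G}) : {subset finsupp f <= A} ->
  linear_ext phi f = \sum_(g <- A) f g *: phi g.
Proof.
move=> fA; apply: big_fset_incl => [|g _ /fsfun_dflt ->]; first exact/fsubsetP.
by rewrite scale0r.
Qed.

Fact linear_ext_linear phi : linear (linear_ext phi).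
Proof.
move=> a f1 f2.
set f := (a *: f1 + f2 : CG).
pose A := (finsupp f `|` (finsupp (f1 : CG) `|` finsupp (f2 : CG)))%fset.
rewrite !(@linear_ext_sub _ _ A); try by move=> g gf; rewrite !inE gf ?orbT.
rewrite scaler_sumr -big_split; apply: eq_bigr => g _ /=.
by rewrite group_algebraD group_algebraZ scalerDl scalerA.
Qed.
HB.instance Definition _ phi :=
  GRing.isLinear.Build _ _ _ _ (linear_ext phi) (linear_ext_linear phi).

Lemma linear_ext_delta phi g : linear_ext phi (ga_delta g) = phi g.
Proof.
rewrite (@linear_ext_sub _ _ [fset g]%fset) ?big_seq_fset1.
  by rewrite ga_deltaE eqxx scale1r.
by move=> h; rewrite mem_finsupp ga_deltaE inE; case: (h == g); rewrite ?eqxx.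
Qed.
End linear_ext.

Lemma linear_ext_id f : linear_ext ga_delta f = f.
Proof.
apply: group_algebraP => h; rewrite /linear_ext.
transitivity (\sum_(g <- finsupp f) (f g *: ga_delta g : CG) h).
  elim/big_rec2: _ => [|g y1 y2 _ <-]; first exact: ga_zeroE.
  by rewrite group_algebraD.
under eq_bigr do rewrite group_algebraZ ga_deltaE.
have [hf|hf] := boolP (h \in finsupp f).
  rewrite (big_fsetD1 h)//= eqxx mulr1 big1_seq ?addr0// => g /=.
  by rewrite !inE eq_sym => /andP[/negPf-> _]; rewrite mulr0.
rewrite (fsfun_dflt hf) big1_seq// => g /= gf.
by case: eqP gf hf => [->->//|_ _ _]; rewrite mulr0.
Qed.

Lemma group_algebra_ind (P : CG -> Prop) :
  (forall g, P (ga_delta g)) ->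
  (forall a f1 f2, P f1 -> P f2 -> P (a *: f1 + f2)) -> forall f, P f.
Proof.
move=> Pdelta Plin f; rewrite -(linear_ext_id f) /linear_ext.
elim/big_rec: _ => [|g f' _ Pf']; last exact: Plin.
by rewrite -(addNr (ga_delta 1)) -scaleN1r; exact: Plin.
Qed.

Definition ga_mul f1 f2 : CG :=
  linear_ext (fun g => linear_ext (fun h => ga_delta (g * h)%g) f2) f1.
Definition ga_one : CG := ga_delta 1%g.

Fact ga_mul_delta g h : ga_mul (ga_delta g) (ga_delta h) = ga_delta (g * h)%g.
Proof. by rewrite /ga_mul !linear_ext_delta. Qed.
Fact ga_mul_linearl f2 : linear (ga_mul^~ f2).
Proof. by move=> a f g; rewrite /ga_mul linearP. Qed.
Fact ga_mul_linearr f1 : linear (ga_mul f1).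
Proof.
move=> a f g; rewrite /ga_mul /linear_ext scaler_sumr -big_split.
apply: eq_bigr => x _ /=; rewrite -![X in _ *: X]/(linear_ext _ _).
by rewrite linearP scalerDr !scalerA (mulrC a).
Qed.

Fact ga_mulA : associative ga_mul.
Proof.
move=> f1 f2 f3.
elim/group_algebra_ind: f1 => [g1|a f f' ih ih']; last first.
  by rewrite !ga_mul_linearl ih ih'.
elim/group_algebra_ind: f2 => [g2|a f f' ih ih']; last first.
  by rewrite !(ga_mul_linearl, ga_mul_linearr) ih ih'.
elim/group_algebra_ind: f3 => [g3|a f f' ih ih']; last first.
  by rewrite !ga_mul_linearr ih ih'.
by rewrite !ga_mul_delta mulgA.
Qed.
Fact ga_mul1l : left_id ga_one ga_mul.
Proof.
by elim/group_algebra_ind=> [g|a f f' ih ih'];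
  rewrite ?ga_mul_linearr ?ih ?ih'// ga_mul_delta mul1g.
Qed.
Fact ga_mull1 : right_id ga_one ga_mul.
Proof.
by elim/group_algebra_ind=> [g|a f f' ih ih'];
  rewrite ?ga_mul_linearl ?ih ?ih'// ga_mul_delta mulg1.
Qed.
Fact ga_mulDl : left_distributive ga_mul +%R.
Proof. by move=> f1 f2 f; have := ga_mul_linearl f 1 f1 f2; rewrite !scale1r. Qed.
Fact ga_mulDr : right_distributive ga_mul +%R.
Proof. by move=> f f1 f2; have := ga_mul_linearr f 1 f1 f2; rewrite !scale1r. Qed.
Fact ga_one_neq0 : ga_one != 0.
Proof.
apply/eqP => /(congr1 (fun f : CG => f 1%g)) /eqP.
by rewrite ga_deltaE eqxx ga_zeroE oner_eq0.
Qed.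
HB.instance Definition _ := GRing.Zmodule_isNzRing.Build CG
  ga_mulA ga_mul1l ga_mull1 ga_mulDl ga_mulDr ga_one_neq0.

Fact ga_scalerAl a f1 f2 : a *: (f1 * f2) = a *: f1 * f2.
Proof.
transitivity (ga_mul (a *: f1 + 0) f2); last by rewrite addr0.
by rewrite ga_mul_linearl (mul0r f2 : ga_mul 0 f2 = 0) addr0.
Qed.
HB.instance Definition _ := GRing.Lmodule_isLalgebra.Build _ CG ga_scalerAl.
Fact ga_scalerAr a f1 f2 : a *: (f1 * f2) = f1 * (a *: f2).
Proof.
transitivity (ga_mul f1 (a *: f2 + 0)); last by rewrite addr0.
by rewrite ga_mul_linearr (mulr0 f1 : ga_mul f1 0 = 0) addr0.
Qed.
HB.instance Definition _ := GRing.Lalgebra_isAlgebra.Build _ CG ga_scalerAr.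

Lemma ga_deltaM g h : ga_delta (g * h)%g = ga_delta g * ga_delta h.
Proof. by rewrite -ga_mul_delta. Qed.

Definition ga_star f : CG :=
  \sum_(g <- finsupp f) Num.Def.conjC (f g) *: ga_delta g^-1%g.

End group_algebra.
Arguments group_algebra : clear implicits.

Section induced.
Context {R : realType} {G : groupType} {H : hilbertType R} (pi : G -> 'L(H)).

Definition induced (f : group_algebra R G) : 'L(H) := linear_ext pi f.

Lemma induced_linear : linear induced. Proof. exact: linear_ext_linear. Qed.

Lemma induced_delta g : induced (ga_delta g) = pi g.
Proof. exact: linear_ext_delta. Qed.

Context (pi_unitary : unitary_representation pi).

Lemma induced1 : induced 1 = 1.
Proof.
case: pi_unitary => piU piM; rewrite induced_delta.
have [V [_ _ VU]] := piU 1%g.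
by rewrite -[LHS]mul1r -VU -mulrA -piM mulg1.
Qed.

Lemma inducedM : {morph induced : f1 f2 / f1 * f2}.
Proof.
case: pi_unitary => _ piM f1 f2.
elim/(@group_algebra_ind R G): f1 => [g1|a f f' ih ih']; last first.
  by rewrite mulrDl -scalerAl !induced_linear ih ih' mulrDl bounded_scalerAl.
elim/(@group_algebra_ind R G): f2 => [g2|a f f' ih ih']; last first.
  by rewrite mulrDr -scalerAr !induced_linear ih ih' mulrDr bounded_scalerAr.
by rewrite -ga_deltaM !induced_delta.
Qed.

Lemma induced_star f : is_adjoint (induced f) (induced (ga_star f)).
Proof.
have [piU piM] := pi_unitary => x y.
have pi1 : pi 1%g = 1 by rewrite -induced_delta induced1.
have -> : induced (ga_star f) =
    \sum_(g <- finsupp f) Num.Def.conjC (f g) *: pi g^-1%g.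
  rewrite /induced /ga_star linear_sum; apply: eq_bigr => g _.
  by rewrite linearZ_LR/= linear_ext_delta.
rewrite /induced /linear_ext !bounded_sum linear_sumlz linear_sumr.
apply: eq_bigr => g _; have [V [piV _ Vpi]] := piU g.
have -> : pi g^-1%g = V.
  by rewrite -[LHS]mul1r -Vpi -mulrA -piM mulgV pi1 mulr1.
by rewrite !boundedZ linearZl_LR linearZr_LR/= conjCK piV.
Qed.

End induced.

Definition prod_group (I : Type) (G : I -> groupType) : Type := forall i, G i.

Section prod_group.
Context {I : Type} (G : I -> groupType).
Implicit Types g h : prod_group G.

HB.instance Definition _ := Choice.copy (prod_group G) (forall i, G i).

Fact prod_groupP g h : (forall i, g i = h i) -> g = h.
Proof. exact: functional_extensionality_dep. Qed.

Let mul g h : prod_group G := fun i => (g i * h i)%g.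
Let one : prod_group G := fun=> 1%g.
Let inv g : prod_group G := fun i => (g i)^-1%g.
Fact prod_mulgA : associative mul.
Proof. by move=> g h k; apply: prod_groupP => i; exact: mulgA. Qed.
Fact prod_mul1g : left_id one mul.
Proof. by move=> g; apply: prod_groupP => i; exact: mul1g. Qed.
Fact prod_mulg1 : right_id one mul.
Proof. by move=> g; apply: prod_groupP => i; exact: mulg1. Qed.
Fact prod_mulVg : left_inverse one inv mul.
Proof. by move=> g; apply: prod_groupP => i; exact: mulVg. Qed.
Fact prod_mulgV : right_inverse one inv mul.
Proof. by move=> g; apply: prod_groupP => i; exact: mulgV. Qed.
HB.instance Definition _ := isGroup.Build (prod_group G)
  prod_mulgA prod_mul1g prod_mulg1 prod_mulVg prod_mulgV.

End prod_group.

Section span.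
Context {K : nzRingType} {V : lmodType K} (A : set V).

Definition lspan : {pred V} := [pred v | `[< exists s : seq (K * V),
  (forall p, p \in s -> A p.2) /\ v = \sum_(p <- s) p.1 *: p.2 >]].

Lemma lspanP v : reflect (exists s : seq (K * V),
  (forall p, p \in s -> A p.2) /\ v = \sum_(p <- s) p.1 *: p.2) (v \in lspan).
Proof. exact: asboolP. Qed.

Lemma mem_lspan v : A v -> v \in lspan.
Proof.
move=> Av; apply/lspanP; exists [:: (1, v)]; split.
  by move=> p; rewrite inE => /eqP->.
by rewrite big_seq1 scale1r.
Qed.

Fact lspan_submod_closed : submod_closed lspan.
Proof.
split=> [|a u v /lspanP[s [sA ->]] /lspanP[t [tA ->]]].
  by apply/lspanP; exists [::]; split=> //; rewrite big_nil.
apply/lspanP; exists ([seq (a * p.1, p.2) | p <- s] ++ t); split.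
  by move=> p; rewrite mem_cat => /orP[/mapP[q /sA ? ->]|/tA].
rewrite big_cat big_map scaler_sumr; congr (_ + _).
by apply: eq_bigr => p _; rewrite scalerA.
Qed.
HB.instance Definition _ :=
  GRing.isSubmodClosed.Build _ _ lspan lspan_submod_closed.

Record span_of := SpanOf { span_val :> V ; _ : span_val \in lspan }.
HB.instance Definition _ := [isSub for span_val].
HB.instance Definition _ := [Choice of span_of by <:].
HB.instance Definition _ := [SubChoice_isSubLmodule of span_of by <:].

End span.

Section tensor_product.
Context {K : nzRingType} {I : choiceType} {H : I -> lmodType K}.

Definition multilinear (F : lmodType K) (f : (forall i, H i) -> F) :=
  forall i (x : forall j, H j), linear (fun u : H i => f (dfwith x u)).

Definition is_tensor_product (T : lmodType K) (Theta : (forall i, H i) -> T) :=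
  multilinear Theta /\
  forall (F : lmodType K) (f : (forall i, H i) -> F), multilinear f ->
    exists2 u : {linear T -> F}, forall x, u (Theta x) = f x &
      forall v : {linear T -> F}, (forall x, v (Theta x) = f x) -> v =1 u.

End tensor_product.

Section infinite_tensor_products.
Context {R : realType} {I : choiceType} {H : I -> hilbertType R}.
Implicit Types x y : forall i, H i.

Definition unit_family x := forall i, `|x i| = 1.

Section unitary_part.
Context {T : lmodType R[i]} (Theta : (forall i, H i) -> T).

Definition un_tensor := span_of (Theta @` unit_family).

(* The elementary tensor of x as an element of the span. It has its meaning
   only for families of unit vectors (utensE), on which alone it is used. *)
Definition utens x : un_tensor := insubd (0 : un_tensor) (Theta x).

Lemma utensE x : unit_family x -> span_val (utens x) = Theta x.
Proof. by move=> ux; rewrite /utens insubdK//; apply: mem_lspan; exists x. Qed.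

Definition is_phi1 (phi1 : {dot un_tensor for Num.Def.conjC}) :=
  forall x y, unit_family x -> unit_family y ->
    phi1 (utens x) (utens y) =
      if `[< finite_set [set i | inner (x i) (y i) != 1] >]
      then \big[*%R/1]_(i \in [set: I]) inner (x i) (y i) else 0.

End unitary_part.

(* L is complete as a hilbertType. *)
Definition is_completion (V : lmodType R[i]) (phi : {dot V for Num.Def.conjC})
    (L : hilbertType R) (iota : {linear V -> L}) :=
  (forall u v, inner (iota u) (iota v) = phi u v) /\ dense (range iota).

Definition abs_summable (a : I -> R[i]) :=
  summable [set: I] (fun i => (ComplexField.Normc.normc (a i))%:E).

Definition C0_sequence x := abs_summable (fun i => `|x i| - 1).

Definition C0_equiv x y := abs_summable (fun i => inner (x i) (y i) - 1).

(* Unordered infinite product: limit along the finite subsets of I. *)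
Definition has_prod (a : I -> R[i]) (l : R[i]) :=
  (fun J : {fset I} => \prod_(i <- J) a i : R[i]^o) @ summability.totally
    --> (l : R[i]^o).

(* Pi x is meaningful only when x is a C0-sequence, its other values are not
   constrained. *)
Definition is_infinite_direct_product (L : hilbertType R)
    (Pi : (forall i, H i) -> L) :=
  dense [set v | v \in lspan (Pi @` C0_sequence)] /\
  forall x y, C0_sequence x -> C0_sequence y ->
    (C0_equiv x y ->
       has_prod (fun i => inner (x i) (y i)) (inner (Pi x) (Pi y))) /\
    (~ C0_equiv x y -> inner (Pi x) (Pi y) = 0).

End infinite_tensor_products.

(* Main.v *)
Require Import Defs.
From HB Require Import structures.
From mathcomp Require Import all_boot all_order all_algebra finmap.
From mathcomp Require Import boolp classical_sets functions cardinality.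
From mathcomp Require Import fsbigop reals ereal topology normedtype esum.
From mathcomp Require Import complex sesquilinear.
From mathcomp Require Import ring.

Set Implicit Arguments.
Unset Strict Implicit.
Unset Printing Implicit Defensive.

Import Order.TTheory GRing.Theory Num.Theory.
Import numFieldNormedType.Exports.

Local Open Scope classical_set_scope.
Local Open Scope ring_scope.

(* (a) Unitaries preserve inner products, hence g |-> (pi_i(g_i) xi_i)_i preserves
   the Gram matrix of each of the two total families; such an action extends
   uniquely to the Hilbert space by unitaries, and uniqueness makes the extension
   multiplicative.

   (b) If sum_g f(g) rho(g) = 0, then sum_g f(g) <(x)pi(g_i)xi_i, (x)eta_i> = 0 for
   all unit families xi, eta. Fix h in the support F of f, and a unit family x0 with
   pi_i(g_i) x0_i <> pi_i(h_i) x0_i for all g in F with g_i <> h_i. Let J be a finite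
   set of indices outside which h agrees with every g in F that differs from h only
   finitely often. For xi equal to x0 and eta equal to pi(h) x0 outside J, the terms
   of the other g vanish by the definition of phi_1, and what remains is
   sum_g f(g) prod_(i in J) <pi_i(g_i) xi_i, eta_i> = 0 with xi_i, eta_i arbitrary for
   i in J. Linear independence of each pi_i(G_i), used one index of J at a time, leaves
   f(h) = 0. *)

(** * Extending a Gram-preserving map from a total family to an isometry *)

Section isometric_extension.
Context {R : realType} {H : hilbertType R}.

Lemma normr_inner (x y : H) : (`|x| == `|y|) = (inner x x == inner y y).
Proof. by rewrite -!inner_normE eqrXn2. Qed.

Lemma isometry_inner (U : {linear H -> H}) : (forall x, `|U x| = `|x|) ->
  forall x y, inner (U x) (U y) = inner x y.
Proof.
move=> U_norm x y.
have U_inner z : inner (U z) (U z) = inner z z by rewrite -!inner_normE U_norm.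
(* The defect [d] is sesquilinear and alternating, so [d x y = - d y x] and, with
   ['i *: y] for [y], [d x y = d y x]. *)
pose d u v : R[i] := inner (U u) (U v) - inner u v.
have dC u v : d u v = - d v u.
  have innerD a b : inner (a + b) (a + b) = inner a a + inner b b + (inner a b + inner b a).
    by rewrite linearDl !linearDr/=; ring.
  have := U_inner (u + v); rewrite (linearD U) !innerD !U_inner => /addrI E.
  by apply/eqP; rewrite /d -addr_eq0 addrACA -opprD E subrr.
have dZ u v : d u ('i *: v) = - 'i * d u v.
  by rewrite /d (linearZ_LR U)/= !linearZr_LR/= conjCi mulrBr.
have dZl u v : d ('i *: u) v = 'i * d u v.
  by rewrite /d (linearZ_LR U)/= !linearZl_LR/= mulrBr.
have /eqP : d x y = - d x y.
  apply: (mulfI (neq0Ci _)).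
  by rewrite -dZl dC dZ mulNr opprK (dC x y) opprK.
by rewrite -addr_eq0 -mulr2n mulrn_eq0/= subr_eq0 => /eqP.
Qed.

Lemma eq_bounded_dense (A B : 'L(H)) (D : set H) :
  dense D -> (forall x, D x -> A x = B x) -> A = B.
Proof.
move=> D_dense AB; apply: boundedP => x; apply/eqP; rewrite -subr_eq0 -normr_le0.
have [M hM] := bounded_bound (A - B).
(* [M] need not be nonnegative, or even real, when [H] is zero; a nonzero [y] forces [0 <= M], so
   [|M|] is a bound in both cases. *)
have hM' y : `|(A - B) y| <= `|M| * `|y|.
  have [->|y0] := eqVneq y 0; first by rewrite linear0 !normr0 mulr0.
  apply: le_trans (hM y) _; apply: ler_wpM2r => //.
  rewrite ger0_norm// -(pmulr_lge0 _ (_ : 0 < `|y|)) ?normr_gt0//.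
  exact: le_trans (hM y).
apply/ler_addgt0Pr => eps eps0; rewrite add0r.
have M1 : 0 < `|M| + 1 by rewrite ltr_wpDl.
have d0 : 0 < eps / (`|M| + 1) by rewrite divr_gt0.
have [||y [yB Dy]] := D_dense (ball x (eps / (`|M| + 1))).
- by exists x; exact: ballxx.
- exact: ball_open.
move: yB; rewrite -ball_normE /= => xy.
have -> : A x - B x = (A - B) (x - y).
  transitivity ((A - B) x - (A - B) y); last by rewrite -(linearB (A - B)).
  have -> : (A - B) y = 0 by change (A y - B y = 0); rewrite AB ?subrr.
  by rewrite subr0.
apply: le_trans (hM' _) _; apply: le_trans (ler_wpM2l _ (ltW xy)) _ => //.
rewrite mulrCA -[leRHS]mulr1 ler_wpM2l ?(ltW eps0)//.
by rewrite ler_pdivrMr// mul1r lerDl.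
Qed.

Section gram.
Context {X : Type}.
Implicit Types (e : X -> H) (s : seq (R[i] * X)).

Definition lincomb e s : H := \sum_(p <- s) p.1 *: e p.2.

Lemma lincombP e a s t :
  lincomb e ([seq (a * p.1, p.2) | p <- s] ++ t) = a *: lincomb e s + lincomb e t.
Proof.
rewrite /lincomb big_cat big_map scaler_sumr; congr (_ + _).
by apply: eq_bigr => p _; rewrite scalerA.
Qed.

Lemma lspan_lincomb e v : v \in lspan (range e) -> exists s, v = lincomb e s.
Proof.
move=> /lspanP[s [+ ->]]; elim: s => [|p s IHs] se.
  by exists [::]; rewrite /lincomb !big_nil.
have [s' ss'] := IHs (fun q qs => se q (@mem_behead _ (p :: s) q qs)).
have [x _ xp] := se p (mem_head _ _).
by exists ((p.1, x) :: s'); rewrite /lincomb !big_cons xp ss'.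
Qed.

Section extension.
Context {e e' : X -> H} (eq_gram : forall x y, inner (e x) (e y) = inner (e' x) (e' y)).

(** The squared norm of a combination expands into its coefficients and the Gram matrix, which [e]
    and [e'] share. *)
Lemma eq_norm_lincomb s : `|lincomb e s| = `|lincomb e' s|.
Proof.
apply/eqP; rewrite normr_inner /lincomb !linear_sumlz; apply/eqP.
apply: eq_bigr => p _; rewrite !linear_sumr; apply: eq_bigr => q _ /=.
by rewrite !linearZr_LR !linearZl_LR/= eq_gram.
Qed.

(* The closure of the graph of [lincomb e s |-> lincomb e' s]. *)
Definition approx_graph (v w : H) := forall eps : R[i], 0 < eps ->
  exists s, `|v - lincomb e s| < eps /\ `|w - lincomb e' s| < eps.

Lemma approx_graph_lincomb s : approx_graph (lincomb e s) (lincomb e' s).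
Proof. by move=> eps eps0; exists s; rewrite !subrr normr0. Qed.

Lemma approx_graphP a v w v' w' : approx_graph v w -> approx_graph v' w' ->
  approx_graph (a *: v + v') (a *: w + w').
Proof.
move=> vw vw' eps eps0.
have a1 : 0 < `|a| + 1 by rewrite ltr_wpDl.
have [s [sv sw]] := vw (eps / 2 / (`|a| + 1)) (divr_gt0 (divr_gt0 eps0 (ltr0Sn _ 1)) a1).
have [t [tv tw]] := vw' (eps / 2) (divr_gt0 eps0 (ltr0Sn _ 1)).
have est (z z' y y' : H) : `|z - y| < eps / 2 / (`|a| + 1) -> `|z' - y'| < eps / 2 ->
    `|a *: z + z' - (a *: y + y')| < eps.
  move=> zy zy'; rewrite opprD addrACA -scalerBr.
  rewrite (le_lt_trans (ler_normD _ _))// [ltRHS](splitr eps) ler_ltD// normrZ.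
  apply: le_trans (ler_wpM2l _ (ltW zy)) _ => //.
  rewrite mulrCA -[leRHS]mulr1 ler_wpM2l ?divr_ge0 ?(ltW eps0)//.
  by rewrite ler_pdivrMr// mul1r lerDl.
by exists ([seq (a * p.1, p.2) | p <- s] ++ t); rewrite !lincombP; split; exact: est.
Qed.

Lemma approx_graph_norm v w : approx_graph v w -> `|w| = `|v|.
Proof.
have norm_near (x y : H) (d : R[i]) : `|x - y| < d -> `|x| <= `|y| + d.
  move=> xy; rewrite -lerBlDl; exact: le_trans (lerB_dist _ _) (ltW xy).
move=> vw; apply/eqP; rewrite eq_le; apply/andP; split.
all: apply/ler_addgt0Pr => eps eps0; rewrite [eps]splitr addrA.
all: have [s [sv sw]] := vw (eps / 2) (divr_gt0 eps0 (ltr0Sn _ 1)).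
- rewrite (le_trans (norm_near _ _ _ sw))// lerD2r -eq_norm_lincomb.
  by apply: norm_near; rewrite distrC.
- rewrite (le_trans (norm_near _ _ _ sv))// lerD2r eq_norm_lincomb.
  by apply: norm_near; rewrite distrC.
Qed.

(** The difference of the two pairs is a pair over 0, and both entries of a pair have the same
    norm. *)
Lemma approx_graph_functional v w w' :
  approx_graph v w -> approx_graph v w' -> w = w'.
Proof.
move=> vw vw'; have := approx_graph_norm (approx_graphP (-1) vw vw').
by rewrite !scaleN1r !addNr normr0 => /eqP; rewrite normr_eq0 addrC subr_eq0 => /eqP.
Qed.

Hypothesis e_total : dense [set v | v \in lspan (range e)].

(** Completeness enters here: combinations of [e] close to [v] have images forming a Cauchy filter,
    and its limit is the value at [v]. *)
Lemma approx_graph_total v : exists w, approx_graph v w.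
Proof.
have near_v (eps : R[i]) : 0 < eps -> exists s, `|v - lincomb e s| < eps.
  move=> eps0; have [||y [yB /lspan_lincomb[s ys]]] := @e_total (ball v eps).
  - by exists v; exact: ballxx.
  - exact: ball_open.
  by exists s; move: yB; rewrite -ball_normE /= ys.
pose F := filter_from [set eps : R[i] | 0 < eps]
  (fun eps => [set w | exists s, w = lincomb e' s /\ `|v - lincomb e s| < eps]).
have F_filter : ProperFilter F.
  apply: filter_from_proper; last first.
    by move=> eps /near_v[s vs]; exists (lincomb e' s), s.
  apply: filter_from_filter; first by exists 1; exact: ltr01.
  move=> a b a0 b0.
  (* The order of [R[i]] is partial, but positive elements are real, hence comparable. *)
  have [ab|ba] := orP (real_leVge (gtr0_real a0) (gtr0_real b0));
    [exists a|exists b] => // w [s [-> vs]]; split; exists s; split=> //;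
    exact: lt_le_trans vs _.
have F_cvg : cvg F.
  apply: cauchy_cvg; apply/cauchy_exP => eps eps0.
  have [s0 vs0] := near_v (eps / 2) (divr_gt0 eps0 (ltr0Sn _ 1)).
  exists (lincomb e' s0); exists (eps / 2); first exact: divr_gt0.
  move=> _ [s [-> vs]]; rewrite -ball_normE /=.
  (* Written as one combination, the difference has the same norm as its counterpart over [e], which
     is estimated through [v]. *)
  have -> : lincomb e' s0 - lincomb e' s =
      lincomb e' ([seq (-1 * p.1, p.2) | p <- s] ++ s0).
    by rewrite lincombP scaleN1r addrC.
  rewrite -eq_norm_lincomb lincombP scaleN1r addrC.
  rewrite -(subrKA v) (le_lt_trans (ler_normD _ _))// [ltRHS](splitr eps).
  by rewrite distrC ltrD.
exists (lim F) => eps eps0.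
have [w [[s [-> vs]]]] : exists w, [set w | exists s, w = lincomb e' s /\
    `|v - lincomb e s| < eps] w /\ ball (lim F) eps w.
  apply: (@filter_ex _ F); apply: filterI; first by exists eps.
  by apply: F_cvg; exact: nbhsx_ballx.
by rewrite -ball_normE /= => ws; exists s.
Qed.

(** The closed graph is everywhere defined and single-valued, so it is the graph of a linear
    isometry. Surjectivity will come from inverse group elements. *)
Lemma isometric_extension : exists U : 'L(H),
  (forall x y, inner (U x) (U y) = inner x y) /\ forall x, U (e x) = e' x.
Proof.
have [U UP] := choice approx_graph_total.
have U_linear : linear U.
  by move=> a x y; apply: approx_graph_functional (UP _) _; exact: approx_graphP.
have U_norm x : `|U x| = `|x| by exact: approx_graph_norm (UP x).
have U_bounded : U \in @bounded_operator R H.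
  by apply/bounded_operatorP; split=> //; exists 1 => x; rewrite mul1r U_norm.
exists (Bounded U_bounded); split=> [|x].
  by apply: (isometry_inner (U := Bounded U_bounded)).
apply: approx_graph_functional (UP _) _.
by have := approx_graph_lincomb [:: (1, x)]; rewrite /lincomb !big_seq1 !scale1r.
Qed.

End extension.

Lemma eq_bounded_total (A B : 'L(H)) e :
  dense [set v | v \in lspan (range e)] -> (forall x, A (e x) = B (e x)) -> A = B.
Proof.
move=> e_total AB; apply: (eq_bounded_dense e_total) => _ /lspan_lincomb[s ->].
rewrite /lincomb !linear_sum; apply: eq_bigr => p _ /=.
by rewrite !linearZ_LR; congr (_ *: _); exact: AB.
Qed.

(** The action laws are required only after applying [e], so they can be checked on a subtype
    without comparing membership proofs. *)
Lemma unitary_representation_of_action (G : groupType) e (act : G -> X -> X) :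
  dense [set v | v \in lspan (range e)] ->
  (forall g x y, inner (e (act g x)) (e (act g y)) = inner (e x) (e y)) ->
  (forall x, e (act 1%g x) = e x) ->
  (forall g h x, e (act (g * h)%g x) = e (act g (act h x))) ->
  exists rho : G -> 'L(H),
    unitary_representation rho /\ forall g x, rho g (e x) = e (act g x).
Proof.
move=> e_total act_inner act1 actM.
have /choice[rho rhoP] g : exists U : 'L(H),
    (forall x y, inner (U x) (U y) = inner x y) /\ forall x, U (e x) = e (act g x).
  by apply: isometric_extension => // x y; rewrite act_inner.
have rho1 : rho 1%g = 1.
  by apply: eq_bounded_total e_total _ => x; rewrite (rhoP _).2 act1.
have rhoM : {morph rho : g h / (g * h)%g >-> g * h}.
  move=> g h; apply: eq_bounded_total e_total _ => x.
  by rewrite boundedM !(rhoP _).2 actM.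
exists rho; split=> [|g x]; last by rewrite (rhoP _).2.
(* The adjoint is the operator of the inverse: write [y] as [rho g (rho g^-1 y)] and cancel [rho g]
   on both sides of the inner product. *)
split=> // g; exists (rho g^-1%g).
have rhoV : rho g * rho g^-1%g = 1 by rewrite -rhoM mulgV.
split=> //; last by rewrite -rhoM mulVg.
by move=> x y; rewrite -[in LHS](bounded1 y) -rhoV boundedM (rhoP _).1.
Qed.

End gram.
End isometric_extension.

(** * The coordinatewise action of the product group *)

Lemma unitary_inner (R : realType) (H : hilbertType R) (U : 'L(H)) x y :
  unitary U -> inner (U x) (U y) = inner x y.
Proof. by case=> V [UV _ VU]; rewrite UV -boundedM VU bounded1. Qed.

Lemma unitary_representation1 (R : realType) (H : hilbertType R) (G : groupType)
  (pi : G -> 'L(H)) : unitary_representation pi -> pi 1%g = 1.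
Proof. by move=> piU; rewrite -induced_delta -(induced1 piU). Qed.

Section product_action.
Context {R : realType} {I : choiceType} {H : I -> hilbertType R}.
Context {G : I -> groupType} (pi : forall i, G i -> 'L(H i)).
Arguments pi : clear implicits.
Hypothesis pi_unitary : forall i, unitary_representation (pi i).
Implicit Types (g h : prod_group G) (x y : forall i, H i).

Definition prod_act g x i : H i := pi i (g i) (x i).

Let act := prod_act.

Lemma prod_act_inner g x y i : inner (act g x i) (act g y i) = inner (x i) (y i).
Proof. exact: (unitary_inner _ _ ((pi_unitary i).1 _)). Qed.

Lemma prod_act_norm g x i : `|act g x i| = `|x i|.
Proof. exact: (unitary_norm _ ((pi_unitary i).1 _)). Qed.

Lemma prod_act1 x : act 1%g x = x.
Proof.
apply: functional_extensionality_dep => i.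
by rewrite /act /prod_act (unitary_representation1 (pi_unitary i)).
Qed.

Lemma prod_actM g h x : act (g * h)%g x = act g (act h x).
Proof.
apply: functional_extensionality_dep => i.
by rewrite /act /prod_act [pi i _](pi_unitary i).2.
Qed.

Lemma prod_act_unit_family g x : unit_family x -> unit_family (act g x).
Proof. by move=> ux i; rewrite prod_act_norm. Qed.

Lemma prod_act_C0_sequence g x : C0_sequence x -> C0_sequence (act g x).
Proof.
rewrite /C0_sequence; congr abs_summable.
by apply/funext => i; rewrite prod_act_norm.
Qed.

Lemma prod_act_C0_equiv g x y : C0_equiv (act g x) (act g y) = C0_equiv x y.
Proof.
by congr abs_summable; apply/funext => i; rewrite prod_act_inner.
Qed.

Lemma unit_family_C0_sequence x : unit_family x -> C0_sequence x.
Proof.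
move=> ux; rewrite /C0_sequence /abs_summable /summable esum1 ?ltry// => i _.
by rewrite ux subrr /ComplexField.Normc.normc/= expr0n/= addr0 sqrtr0 normr0.
Qed.

(** Common source of both representations: [P] will be the unit families for [K] and the
    C0-sequences for [L]. The index type is the subtype of [P], where the Gram identity is
    available. *)
Lemma prod_act_representation (L : hilbertType R) (e : (forall i, H i) -> L)
    (P : set (forall i, H i)) : (forall g x, P x -> P (act g x)) ->
  dense [set v | v \in lspan (e @` P)] ->
  (forall g x y, P x -> P y -> inner (e (act g x)) (e (act g y)) = inner (e x) (e y)) ->
  exists rho : prod_group G -> 'L(L), unitary_representation rho /\
    forall g x, P x -> rho g (e x) = e (act g x).
Proof.
move=> actP e_total act_inner.
pose X := {x | P x}; pose e' (x : X) := e (sval x).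
pose act' g (x : X) : X := exist _ _ (actP g _ (svalP x)).
have e'E : range e' = e @` P.
  apply/seteqP; split=> [_ [[x Px] _ <-]|_ [x Px <-]]; first by exists x.
  by exists (exist _ x Px).
have [||||rho [rhoU rhoE]] := @unitary_representation_of_action _ _ X _ e' act'.
- by rewrite e'E.
- by move=> g [x Px] [y Py]; exact: act_inner.
- by move=> [x Px]; rewrite /e' /= prod_act1.
- by move=> g h [x Px]; rewrite /e' /= prod_actM.
by exists rho; split=> // g x Px; exact: (rhoE g (exist _ x Px)).
Qed.

End product_action.

(** * Totality of the elementary tensors in the completion *)

Section tensor.
Context {R : realType} {I : choiceType} {H : I -> hilbertType R}.
Context {T : lmodType R[i]} {Theta : (forall i, H i) -> T}.

(** Membership in the span is a statement in [T]; the same coefficients serve in the subspace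
    because [val] is linear and injective. *)
Lemma un_tensor_span (u : un_tensor Theta) :
  u \in lspan (utens Theta @` unit_family).
Proof.
suff [v [vE vin]] : exists v : un_tensor Theta, val v = val u /\
    v \in lspan (utens Theta @` unit_family) by rewrite -(val_inj vE).
have /lspanP[s [+ ->]] := valP u.
elim: s => [|p s IHs] sP.
  by exists 0; rewrite big_nil raddf0 rpred0.
have [|v [vE vin]] := IHs; first by move=> q qs; apply: sP; rewrite inE qs orbT.
have [x ux xp] := sP p (mem_head _ _).
exists (p.1 *: utens Theta x + v); split.
  rewrite big_cons -[p.2]xp -vE -(utensE Theta ux).
  exact: (linearP (val : un_tensor Theta -> T)).
by rewrite rpredD// rpredZ// mem_lspan//; exists x.
Qed.

Context {phi1 : {dot un_tensor Theta for Num.Def.conjC}}.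
Context {K : hilbertType R} {iota : {linear un_tensor Theta -> K}}.
Hypothesis K_completion : is_completion phi1 iota.

Lemma iota_utens_total :
  dense [set v | v \in lspan ((iota \o utens Theta) @` unit_family)].
Proof.
move=> O O0 oO; have [v [Ov [u _ uv]]] := K_completion.2 O O0 oO.
exists v; split=> //=; rewrite -{}uv.
have /lspanP[s [sP ->]] := un_tensor_span u.
rewrite raddf_sum big_seq rpred_sum// => p ps.
have [x ux xp] := sP p ps.
by rewrite /= linearZ_LR rpredZ// mem_lspan//; exists x => //=; rewrite xp.
Qed.

End tensor.

(** * Uniqueness of infinite products and equality of vectors *)

Lemma has_prod_unique (R : realType) (I : choiceType) (a : I -> R[i]) l l' :
  has_prod a l -> has_prod a l' -> l = l'.
Proof.
have P : ProperFilter (@summability.totally I) by exact: summability.totally_filter.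
exact: (@cvg_unique (R[i]^o) (@norm_hausdorff _ (R[i]^o)) _ _ l l').
Qed.

Lemma inner_eq0 (R : realType) (H : hilbertType R) (v : H) :
  (forall w, inner v w = 0) -> v = 0.
Proof.
by move=> /(_ v) vv; apply/eqP; rewrite -normr_eq0 -sqrf_eq0 inner_normE vv.
Qed.

(** The equality case of Cauchy-Schwarz: the squared norm of [u - v] expands to 0. *)
Lemma eq_unit_vectors (R : realType) (H : hilbertType R) (u v : H) :
  `|u| = 1 -> `|v| = 1 -> inner u v = 1 -> u = v.
Proof.
move=> u1 v1 uv; apply/eqP; rewrite -subr_eq0 -normr_eq0 -sqrf_eq0 inner_normE.
have vu : inner v u = 1.
  transitivity ((-1) ^+ false * Num.Def.conjC (inner u v)); first exact: hermC.
  by rewrite uv mul1r rmorph1.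
have -> : inner (u - v) (u - v) = inner u u - inner u v - (inner v u - inner v v).
  by rewrite linearBl !linearBr.
by rewrite uv vu -!inner_normE u1 v1 expr1n !subrr.
Qed.

(** * Vectors outside finitely many kernels *)

Section avoid.
Context {R : realType} {H : hilbertType R}.
Implicit Types (s : seq 'L(H)) (v w : H).

(* The line [n%:R *: v + w] meets each kernel at most once, as [v] is in none. *)
Lemma eventually_neq0 s v w : (forall A, A \in s -> A v != 0) ->
  exists N, forall n, (N <= n)%N -> forall A, A \in s -> A (n%:R *: v + w) != 0.
Proof.
elim: s => [|A s IHs] sv; first by exists 0%N.
have [|N NP] := IHs; first by move=> B Bs; apply: sv; rewrite inE Bs orbT.
have Av : A v != 0 by apply: sv; exact: mem_head.
have [[m Am]|noA] := pselect (exists m, A (m%:R *: v + w) = 0); last first.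
  exists N => n Nn B; rewrite inE => /predU1P[->|]; last exact: NP.
  by apply/eqP => An; apply: noA; exists n.
exists (maxn N m.+1) => n; rewrite geq_max => /andP[Nn mn] B.
rewrite inE => /predU1P[->|]; last exact: NP.
apply: contra Av => /eqP An.
have : (n%:R - m%:R) *: A v = A (n%:R *: v + w) - A (m%:R *: v + w).
  rewrite -linearB -linearZ_LR/=.
  by congr (A _); rewrite opprD addrACA subrr addr0 scalerBl.
rewrite An Am subrr.
move/eqP; rewrite scaler_eq0 subr_eq0 eqr_nat => /orP[/eqP nm|//].
by rewrite nm ltnn in mn.
Qed.

(** A vector space over an infinite field is not a finite union of proper subspaces. *)
Lemma common_neq0 s : (forall A, A \in s -> A != 0) ->
  exists v, forall A, A \in s -> A v != 0.
Proof.
elim: s => [|A s IHs] s0; first by exists 0.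
have [|v vP] := IHs; first by move=> B Bs; apply: s0; rewrite inE Bs orbT.
have [Av|Av] := eqVneq (A v) 0; last first.
  by exists v => B; rewrite inE => /predU1P[->|/vP].
have [w Aw] : exists w, A w != 0.
  apply: contrapT => noA; have /eqP := s0 A (mem_head _ _); apply.
  apply: boundedP => w; have [//|Aw] := eqVneq (A w) 0.
  by case: noA; exists w.
(* A large multiple of [v] keeps the earlier operators nonzero, while [A] sees only [w], since
   [A v = 0]. *)
have [N NP] := eventually_neq0 w vP; exists (N%:R *: v + w) => B.
rewrite inE => /predU1P[->|]; last exact: NP.
have -> : A (N%:R *: v + w) = N%:R *: A v + A w by exact: linearP.
by rewrite Av scaler0 add0r.
Qed.

End avoid.

(** * Linear independence in finite tensor products *)

Lemma induced_free (R : realType) (G : groupType) (H : hilbertType R)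
    (pi : G -> 'L(H)) (J : Type) (r : seq J) (k : J -> G) (c : J -> R[i]) :
  injective (induced pi) ->
  (forall x y, \sum_(j <- r) c j * inner (pi (k j) x) y = 0) ->
  forall h, \sum_(j <- r | k j == h) c j = 0.
Proof.
move=> pi_inj c0 h.
(* [k] may repeat values, as different families can share a coordinate; the coefficient of [f] at
   [h] is thus the sum of [c] over a fibre of [k]. *)
pose f : group_algebra R G := \sum_(j <- r) c j *: ga_delta (k j).
have f0 : f = 0.
  apply: pi_inj; rewrite /induced linear0 linear_sum.
  apply: boundedP => x; apply: inner_eq0 => y.
  rewrite bounded_sum linear_sumlz -[RHS](c0 x y); apply: eq_bigr => j _ /=.
  have -> : linear_ext pi (c j *: ga_delta (k j)) = c j *: pi (k j).
    by rewrite linearZ_LR/= linear_ext_delta.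
  exact: linearZl_LR.
transitivity (f h); last by rewrite f0; exact: ga_zeroE.
transitivity (\sum_(j <- r) (c j *: ga_delta (k j) : group_algebra R G) h).
  rewrite big_mkcond; apply: eq_bigr => j _.
  by rewrite group_algebraZ ga_deltaE eq_sym; case: eqP; rewrite ?mulr1 ?mulr0.
rewrite /f; elim/big_rec2: _ => [|j y1 y2 _ ->]; first by rewrite ga_zeroE.
by rewrite group_algebraD.
Qed.

Section finite_tensor.
Context {R : realType} {I : choiceType} {H : I -> hilbertType R}.
Context {G : I -> groupType} (pi : forall i, G i -> 'L(H i)).
Arguments pi : clear implicits.
Hypothesis pi_inj : forall i, injective (induced (pi i)).
Implicit Types (s : seq I) (r : seq (prod_group G)) (c : prod_group G -> R[i]).

(** Induction on [s]: with the vectors at the other indices fixed, the relation concerns one group,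
    and [induced_free] splits it by the value of [g i]. *)
Lemma finite_tensor_free s r c : uniq s ->
  (forall x y : forall i, H i,
    \sum_(g <- r) c g * \prod_(i <- s) inner (pi i (g i) (x i)) (y i) = 0) ->
  forall h : prod_group G, \sum_(g <- r | all (fun i => g i == h i) s) c g = 0.
Proof.
elim: s c => [|i s IHs] c /=.
  move=> _ c0 h; rewrite -[RHS](c0 (fun=> 0) (fun=> 0)).
  by apply: eq_bigr => g _; rewrite big_nil mulr1.
move=> /andP[nis us] c0 h.
rewrite big_mkcondl.
(* The condition at [i] is absorbed into the coefficients, which is why the induction is over all
   [c]. *)
apply: (IHs (fun g => if g i == h i then c g else 0) us) => x y.
pose k g : G i := g i.
rewrite -[RHS](@induced_free _ _ _ (pi i) _ r k (fun g => c g *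
  \prod_(j <- s) inner (pi j (g j) (x j)) (y j)) (@pi_inj i) _ (h i)).
  by rewrite [RHS]big_mkcond; apply: eq_bigr => g _; rewrite /k; case: ifP; rewrite ?mul0r.
(* Changing the vectors at [i] alone leaves the other factors intact, since [i] does not occur in
   [s]. *)
move=> u v; rewrite -[RHS](c0 (dfwith x u) (dfwith y v)); apply: eq_bigr => g _.
rewrite big_cons !dfwith_in -mulrA; congr (_ * _); rewrite mulrC; congr (_ * _).
rewrite !big_seq; apply: eq_bigr => j js.
by rewrite !dfwith_out//; apply: contraNneq nis => ->.
Qed.

Hypothesis H_neq0 : forall i, exists v : H i, v != 0.

(** Where [x i] is 0, any unit vector of the nonzero space [H i] will do. *)
Lemma unit_family_direction (x : forall i, H i) :
  exists2 u, unit_family u & forall i, x i = `|x i| *: u i.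
Proof.
have norm1 i (v : H i) : v != 0 -> `| `|v|^-1 *: v | = 1.
  by move=> v0; rewrite normrZ normfV normr_id mulVf// normr_eq0.
have uP i : exists u : H i, `|u| = 1 /\ x i = `|x i| *: u.
  have [xi0|xi0] := eqVneq (x i) 0.
    have [v v0] := H_neq0 i; exists (`|v|^-1 *: v).
    by rewrite norm1// xi0 normr0 scale0r.
  by exists (`|x i|^-1 *: x i); rewrite norm1// scalerA divff ?scale1r// normr_eq0.
by exists (fun i => sval (cid (uP i))) => i; case: cid => u [].
Qed.

(** By homogeneity: the norms of the vectors factor out of every term alike. *)
Lemma finite_tensor_free_unit s r c : uniq s ->
  (forall x y : forall i, H i, unit_family x -> unit_family y ->
    \sum_(g <- r) c g * \prod_(i <- s) inner (pi i (g i) (x i)) (y i) = 0) ->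
  forall h : prod_group G, \sum_(g <- r | all (fun i => g i == h i) s) c g = 0.
Proof.
move=> us c0; apply: finite_tensor_free => // x y.
have [[u u1 xu] [v v1 yv]] := (unit_family_direction x, unit_family_direction y).
rewrite -[RHS](mulr0 (\prod_(i <- s) (`|x i| * `|y i|))).
rewrite -[in RHS](c0 _ _ u1 v1) mulr_sumr; apply: eq_bigr => g _; rewrite mulrCA -big_split; congr (_ * _).
apply: eq_bigr => i _ /=.
have E (a b : R[i]) w z : inner (pi i (g i) (a *: w)) (b *: z) =
    a * (Num.Def.conjC b * inner (pi i (g i) w) z).
  by rewrite (linearZ_LR (pi i (g i))) linearZl_LR/= linearZr_LR.
rewrite -mulrA -[X in _ * (X * _)](CrealP (normr_real (y i))) -E.
by rewrite -xu -yv.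
Qed.

End finite_tensor.

(** * Linear independence in the infinite tensor product *)

Section tensor_free.
Context {R : realType} {I : choiceType} {H : I -> hilbertType R}.
Context {G : I -> groupType} (pi : forall i, G i -> 'L(H i)).
Arguments pi : clear implicits.
Hypothesis H_neq0 : forall i, exists v : H i, v != 0.
Hypothesis pi_unitary : forall i, unitary_representation (pi i).
Hypothesis pi_inj : forall i, injective (induced (pi i)).
Context {T : lmodType R[i]} {Theta : (forall i, H i) -> T}.
Context {phi1 : {dot un_tensor Theta for Num.Def.conjC}}.
Hypothesis phi1P : is_phi1 phi1.

Lemma pi_injective i : injective (pi i).
Proof.
move=> g h gh; have : ga_delta g = ga_delta h :> group_algebra R (G i).
  by apply: (@pi_inj i); rewrite !induced_delta.
move=> /(congr1 (fun f : group_algebra R (G i) => f g)); rewrite !ga_deltaE eqxx.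
by case: eqP => // _ /eqP; rewrite oner_eq0.
Qed.

(** Injectivity of [pi i] makes the differences [pi i g - pi i h] nonzero operators; a vector
    outside all their kernels is then normalised. *)
Lemma separating_unit_vector i (r : seq (G i)) (h : G i) :
  exists2 u : H i, `|u| = 1 & forall g, g \in r -> g != h -> pi i g u != pi i h u.
Proof.
(* [1] is there to force [u != 0]. *)
pose s := 1 :: [seq pi i g - pi i h | g <- r & g != h].
have [A|u uP] := @common_neq0 _ _ s.
  rewrite inE => /predU1P[->|/mapP[g + ->]]; last first.
    by rewrite mem_filter subr_eq0 => /andP[gh _]; rewrite (inj_eq (@pi_injective i)).
  have [v v0] := H_neq0 i; apply: contra v0 => /eqP E.
  by rewrite -[v]bounded1 E.
have u0 : u != 0 by have := uP 1 (mem_head _ _); rewrite bounded1.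
exists (`|u|^-1 *: u) => [|g gr gh].
  by rewrite normrZ normfV normr_id mulVf// normr_eq0.
rewrite -subr_eq0.
have -> : pi i g (`|u|^-1 *: u) - pi i h (`|u|^-1 *: u) =
    `|u|^-1 *: (pi i g - pi i h) u.
  by rewrite (linearZ_LR (pi i g)) (linearZ_LR (pi i h)) -scalerBr.
have /negPf neq : (pi i g - pi i h) u != 0; last first.
  by rewrite scaler_eq0 invr_eq0 normr_eq0 (negPf u0) neq.
apply: uP; rewrite inE; apply/orP; right.
by apply/mapP; exists g => //; rewrite mem_filter gh gr.
Qed.

(** Matrix coefficients at elementary tensors suffice, so the argument uses [phi1] and stays inside
    [un_tensor]. *)
Lemma utens_prod_act_free (f : group_algebra R (prod_group G)) :
  (forall x y, unit_family x -> unit_family y ->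
     \sum_(g <- finsupp f) f g * phi1 (utens Theta (prod_act pi g x)) (utens Theta y) = 0) ->
  f = 0.
Proof.
move=> f0; apply: group_algebraP => h; rewrite ga_zeroE.
have [hf|/fsfun_dflt//] := boolP (h \in finsupp f).
pose diff (g : prod_group G) := [set i | g i != h i].
pose near g := `[< finite_set (diff g) >].
have [J JP] : exists J : {fset I}, forall g, g \in finsupp f -> near g ->
    forall i, i \notin J -> g i = h i.
  have : finite_set (\bigcup_(g in [set g | g \in finsupp f])
      (if near g then diff g else set0)).
    apply: bigcup_finite => [|g _]; first exact: finite_fset.
    by rewrite /near; case: asboolP.
  move=> /finite_fsetP[J JE]; exists J => g gf ng i.
  apply: contraNeq => gi; suff : [set` J] i by [].
  by rewrite -JE; exists g => //; rewrite ng.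
have sep i := @separating_unit_vector i [seq (g : prod_group G) i | g <- finsupp f] (h i).
pose x0 i : H i := s2val (cid2 (sep i)).
have x0_unit : unit_family x0 by move=> i; exact: (s2valP (cid2 (sep i))).
have x0_sep i g : g \in finsupp f -> g i != h i -> pi i (g i) (x0 i) != pi i (h i) (x0 i).
  by move=> gf gh; apply: (s2valP' (cid2 (sep i))) => //; exact: map_f.
have pi_inner i a v w : inner (pi i a v) (pi i a w) = inner v w.
  exact: (unitary_inner _ _ ((pi_unitary i).1 _)).
have pi_norm i a v : `|pi i a v| = `|v|.
  exact: (unitary_norm _ ((pi_unitary i).1 _)).
(* An element [near] [h] that agrees with [h] on [J] is [h] itself, so the sum has the single term
   [f h]. *)
suff <- : \sum_(g <- [seq g <- finsupp f | near g] | all (fun i => g i == h i) J) f g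
    = f h.
  apply: (finite_tensor_free_unit pi_inj H_neq0) => // x y x_unit y_unit.
  pose X i := if i \in J then x i else x0 i.
  pose Y i := if i \in J then y i else pi i (h i) (x0 i).
  have X_unit : unit_family X by move=> i; rewrite /X; case: ifP.
  have Y_unit : unit_family Y by move=> i; rewrite /Y; case: ifP; rewrite ?pi_norm.
  rewrite -[RHS](f0 X Y)// big_filter big_mkcond/= !big_seq; apply: eq_bigr => g gf.
  rewrite (phi1P (prod_act_unit_family pi_unitary _ X_unit))//.
  case: ifP => ng.
    (* Outside [J], [g i = h i], so both vectors are [pi i (h i) (x0 i)]. *)
    have outJ i : i \notin J -> inner (prod_act pi g X i) (Y i) = 1.
      move=> iJ; rewrite /prod_act /X /Y (negPf iJ) (JP g)// pi_inner.
      by rewrite -inner_normE x0_unit expr1n.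
    rewrite asboolT; last first.
      apply: (@sub_finite_set _ _ [set` J]); last exact: finite_fset.
      by move=> i /=; apply: contraR => /outJ ->.
    rewrite (@fsbigTE _ _ _ _ J)//; congr (_ * _); rewrite !big_seq; apply: eq_bigr => i iJ.
    by rewrite /prod_act /X /Y iJ.
  (* If almost all factors were 1, then [g i] and [h i] would agree on [x0 i] for almost all [i]; as
     [x0] separates them, [g] would be [near] [h]. *)
  rewrite asboolF ?mulr0// => fin; move/negP: ng; apply; apply/asboolP.
  apply: (@sub_finite_set _ _ ([set` J] `|` [set i | inner (prod_act pi g X i) (Y i) != 1])).
    move=> i gi /=; have [iJ|iJ] := boolP (i \in J); [by left|right].
    rewrite /prod_act /X /Y (negPf iJ); apply: contra (x0_sep _ _ gf gi) => /eqP E.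
    by apply/eqP; apply: eq_unit_vectors; rewrite ?pi_norm ?x0_unit.
  by rewrite finite_setU; split=> //; exact: finite_fset.
have near_h : near h.
  by apply/asboolP; rewrite (_ : diff h = set0)// -subset0 => i; rewrite /diff/= eqxx.
rewrite big_filter_cond big_mkcond (bigD1_seq h)//= near_h.
have -> : all (fun i => h i == h i) J by apply/allP.
rewrite big1_seq ?addr0// => g /andP[gnh gf]; case: ifP => // /andP[ng gh].
case/eqP: gnh; apply: prod_groupP => i.
by have [iJ|iJ] := boolP (i \in J); [exact/eqP/(allP gh)|exact: (JP g)].
Qed.

End tensor_free.

Theorem corollary5p7 (R : realType) (I : choiceType)
  (I_infinite : infinite_set [set: I])
  (H : I -> hilbertType R) (H_neq0 : forall i, exists v : H i, v != 0)
  (G : I -> groupType) (pi : forall i, G i -> 'L(H i))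
  (pi_unitary : forall i, unitary_representation (pi i))
  (* the algebraic tensor product, and the completion of its unitary part *)
  (T : lmodType R[i]) (Theta : (forall i, H i) -> T)
  (T_tensor : is_tensor_product Theta)
  (phi1 : {dot un_tensor Theta for Num.Def.conjC}) (phi1P : is_phi1 phi1)
  (K : hilbertType R) (iota : {linear un_tensor Theta -> K})
  (K_completion : is_completion phi1 iota)
  (* the infinite direct product of von Neumann *)
  (L : hilbertType R) (Pi : (forall i, H i) -> L)
  (L_product : is_infinite_direct_product Pi) :
  let extends_tensor (rho : prod_group G -> 'L(K)) :=
    forall (g : prod_group G) (xi : forall i, H i), unit_family xi ->
      rho g (iota (utens Theta xi)) =
        iota (utens Theta (fun i => pi i (g i) (xi i))) in
  let extends_product (rho : prod_group G -> 'L(L)) :=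
    forall (g : prod_group G) (xi : forall i, H i), unit_family xi ->
      rho g (Pi xi) = Pi (fun i => pi i (g i) (xi i)) in
  ((exists rho : prod_group G -> 'L(K),
      unitary_representation rho /\ extends_tensor rho) /\
   (exists rho : prod_group G -> 'L(L),
      unitary_representation rho /\ extends_product rho)) /\
  ((forall i, injective (induced (pi i))) ->
   forall rho : prod_group G -> 'L(K),
     unitary_representation rho -> extends_tensor rho ->
     injective (induced rho)).
Proof.
move=> extends_tensor extends_product; split; first split.
- apply: (prod_act_representation pi_unitary (prod_act_unit_family pi_unitary)
    (iota_utens_total K_completion)) => g x y ux uy /=.
  (* Both the finiteness test and the product defining [phi1] depend only on the coordinatewise
     inner products. *)
  rewrite !K_completion.1 !phi1P//; try exact: prod_act_unit_family.
  by under eq_fun do rewrite prod_act_inner//;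
     under eq_fsbigr do rewrite prod_act_inner//.
- have [|rho [rhoU rhoE]] := prod_act_representation pi_unitary
    (prod_act_C0_sequence pi_unitary) L_product.1.
    move=> g x y Cx Cy.
    have [prodxy orthxy] := L_product.2 _ _ Cx Cy.
    have [prodgxy orthgxy] := L_product.2 _ _ (prod_act_C0_sequence pi_unitary g Cx)
      (prod_act_C0_sequence pi_unitary g Cy).
    have equivE := prod_act_C0_equiv pi_unitary g x y.
    have [xy|xy] := pselect (C0_equiv x y).
      (* Inner products in [L] are specified only as limits; here both are limits of the same
         partial products. *)
      apply: has_prod_unique (prodxy xy).
      have := prodgxy; rewrite equivE => /(_ xy); congr has_prod.
      by apply/funext => i; rewrite prod_act_inner.
    by rewrite (orthxy xy) orthgxy// equivE.
  exists rho; split=> // g x ux; apply: rhoE.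
  exact: unit_family_C0_sequence.
- move=> pi_inj rho rhoU rhoE.
  suff ker0 f : induced rho f = 0 -> f = 0.
    move=> f1 f2 E; apply/eqP; rewrite -subr_eq0; apply/eqP/ker0.
    by rewrite /induced linearB; apply/eqP; rewrite subr_eq0; apply/eqP.
  move=> f0; apply: (utens_prod_act_free H_neq0 pi_unitary pi_inj phi1P).
  move=> x y ux uy.
  (* The vanishing operator is tested on one pair of elementary tensors, and [iota] carries the
     pairing back to [phi1]. *)
  have := congr1 (fun A : 'L(K) => inner (A (iota (utens Theta x))) (iota (utens Theta y))) f0.
  rewrite linear0l /induced /linear_ext bounded_sum linear_sumlz => E.
  rewrite -[RHS]E; apply: eq_bigr => g _.
  by rewrite boundedZ rhoE// linearZl_LR/= K_completion.1.
Qed.
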